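(* Let $g,\gamma\in\mathbb{C}^N$. If $$\operatorname{Re}\big(\overline{\hat g(\ell)}\,\hat\gamma(\ell)\big)\ge 0\quad\forall\,\ell=1,\dots,N-1,\qquad\text{and}\qquad \operatorname{Re}\big(\overline{\hat g(0)}\,\hat\gamma(0)\big)>0,$$ then $\langle T_n\gamma,T_ng\rangle\neq 0$ for all $n\in\{1,\dots,N\}$.
   Context: Let $G=(V,E)$ be a finite, connected, undirected, weighted simple graph with vertex set $V=\{1,\dots,N\}$, and let $W=(W_{ij})$ be its weighted adjacency matrix: real, symmetric, zero diagonal, $W_{ij}\ge 0$, with $W_{ij}\neq0$ exactly when $i,j$ are adjacent. Let $D=\operatorname{diag}(d_1,\dots,d_N)$ with $d_i=\sum_{j}W_{ij}$, and let $\mathcal{L}=D-W$ be the graph Laplacian. Fix an orthonormal basis $(\chi_0,\dots,\chi_{N-1})$ of $\mathbb{C}^N$ consisting of eigenvectors of $\mathcal{L}$, ordered so that the eigenvalues satisfy $0=\lambda_0<\lambda_1\le\dots\le\lambda_{N-1}$ (so $|\chi_0(i)|=1/\sqrt N$ for all $i$). Signals are vectors $f=(f(1),\dots,f(N))\in\mathbb{C}^N$; the inner product $\langle f,h\rangle=\sum_{i=1}^N f(i)\overline{h(i)}$ is conjugate-linear in the second argument. Graph Fourier transform: $\hat f(\ell)=\langle f,\chi_\ell\rangle$, $\ell=0,\dots,N-1$. Generalized translation, for $n\in\{1,\dots,N\}$: $(T_nf)(i)=\sqrt N\sum_{\ell=0}^{N-1}\hat f(\ell)\overline{\chi_\ell(n)}\chi_\ell(i)$.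 *)

(* Defs.v *)
From mathcomp Require Import all_boot all_order all_algebra.
From mathcomp Require Import reals complex.
Set Implicit Arguments.
Unset Strict Implicit.
Unset Printing Implicit Defensive.
Import Order.TTheory GRing.Theory Num.Theory.
Local Open Scope ring_scope.
Local Open Scope complex_scope.

(* A vertex set of size N is 'I_N, so vertices 1..N are numbered 0..N-1. *)
Definition connected_simple_graph (N : nat) (e : rel 'I_N) : Prop :=
  [/\ symmetric e, irreflexive e & forall i j : 'I_N, connect e i j].

Definition weighted_adjacency (R : realType) (N : nat) (e : rel 'I_N)
    (W : 'M[R]_N) : Prop :=
  [/\ W^T = W, forall i, W i i = 0, forall i j, 0 <= W i j
    & forall i j, W i j != 0 <-> e i j].

Definition degree_mx (R : realType) (N : nat) (W : 'M[R]_N) : 'M[R]_N :=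
  diag_mx (\row_i \sum_j W i j).

Definition laplacian (R : realType) (N : nat) (W : 'M[R]_N) : 'M[R]_N :=
  degree_mx W - W.

Definition inner (R : realType) (N : nat) (f h : 'cV[R[i]]_N) : R[i] :=
  \sum_i f i 0 * conjc (h i 0).

(* N orthonormal vectors of C^N automatically form a basis, and are nonzero,
   hence genuine eigenvectors. *)
Definition orthonormal_basis (R : realType) (N : nat)
    (chi : 'I_N -> 'cV[R[i]]_N) : Prop :=
  forall k l : 'I_N, inner (chi k) (chi l) = (k == l)%:R.

(* Here N = m.+1, so that the index 0 exists. *)
Definition laplacian_eigenbasis (R : realType) (m : nat) (W : 'M[R]_m.+1)
    (lambda : 'I_m.+1 -> R) (chi : 'I_m.+1 -> 'cV[R[i]]_m.+1) : Prop :=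
  [/\ orthonormal_basis chi,
      forall l, map_mx (real_complex R) (laplacian W) *m chi l
                = (lambda l)%:C *: chi l,
      lambda ord0 = 0,
      forall l, l != ord0 -> 0 < lambda l
    & forall k l : 'I_m.+1, (k <= l)%N -> lambda k <= lambda l].

Definition gft (R : realType) (N : nat) (chi : 'I_N -> 'cV[R[i]]_N)
    (f : 'cV[R[i]]_N) (l : 'I_N) : R[i] :=
  inner f (chi l).

Definition translation (R : realType) (N : nat) (chi : 'I_N -> 'cV[R[i]]_N)
    (n : 'I_N) (f : 'cV[R[i]]_N) : 'cV[R[i]]_N :=
  \col_i ((Num.sqrt (N%:R : R))%:C *
          \sum_l gft chi f l * conjc (chi l n 0) * chi l i 0).

(* Main.v *)
Require Import Defs.
From mathcomp Require Import all_boot all_order all_algebra.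
From mathcomp Require Import reals complex.
Import Order.TTheory GRing.Theory Num.Theory.
Local Open Scope ring_scope.
Local Open Scope complex_scope.

(** The translate [T_n f] has Fourier coefficients
    [sqrt N * fhat l * conj (chi_l n)], so by Parseval
    [<T_n gamma, T_n g>
       = N * sum_l gammahat l * conj (ghat l) * |chi_l n| ^ 2].
    The real part of every term is nonnegative, and the real part of the term
    [l = 0] is positive as soon as [chi_0 n != 0]; hence the sum is nonzero
    ([inner_translation]).

    That [chi_0] vanishes nowhere is seen by expanding the constant vector
    [1] in the basis. Since [W] is symmetric, the columns of the Laplacian sum
    to zero, so an eigenvector for a nonzero eigenvalue has entries summing to
    zero, that is, it is orthogonal to [1]
    ([sum_laplacian_eigenvector]). Only [lambda_0] may vanish, so the expansion
    collapses to [1 = <1, chi_0> chi_0], and no entry of the right-hand side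
    is zero ([chi0_neq0]). *)

Lemma inner_suml (R : realType) (N : nat) (u : 'I_N -> 'cV[R[i]]_N)
    (a : 'I_N -> R[i]) (h : 'cV[R[i]]_N) :
  inner (\sum_l a l *: u l) h = \sum_l a l * inner (u l) h.
Proof.
rewrite /inner; under [RHS]eq_bigr => l _ do rewrite mulr_sumr.
rewrite exchange_big; apply: eq_bigr => i _.
rewrite summxE mulr_suml; apply: eq_bigr => l _.
by rewrite mxE mulrA.
Qed.

Lemma inner_sumr (R : realType) (N : nat) (u : 'I_N -> 'cV[R[i]]_N)
    (b : 'I_N -> R[i]) (f : 'cV[R[i]]_N) :
  inner f (\sum_l b l *: u l) = \sum_l conjc (b l) * inner f (u l).
Proof.
rewrite /inner; under [RHS]eq_bigr => l _ do rewrite mulr_sumr.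
rewrite exchange_big; apply: eq_bigr => i _.
rewrite summxE rmorph_sum mulr_sumr; apply: eq_bigr => l _.
by rewrite mxE rmorphM /= mulrCA.
Qed.

Lemma parseval (R : realType) (N : nat) (chi : 'I_N -> 'cV[R[i]]_N)
    (a b : 'I_N -> R[i]) :
  orthonormal_basis chi ->
  inner (\sum_l a l *: chi l) (\sum_l b l *: chi l)
  = \sum_l a l * conjc (b l).
Proof.
move=> ortho; rewrite inner_suml; apply: eq_bigr => l _; congr (_ * _).
rewrite inner_sumr (bigD1 l) //= ortho eqxx mulr1 big1 ?addr0 // => k neq_kl.
by rewrite ortho eq_sym (negbTE neq_kl) mulr0.
Qed.

(** Orthonormality says that the matrix with rows [conj chi_l] is a left
    inverse of the matrix with columns [chi_l]; for square matrices it is then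
    a right inverse as well, and this is completeness. *)
Lemma fourier_inversion (R : realType) (N : nat)
    (chi : 'I_N -> 'cV[R[i]]_N) (f : 'cV[R[i]]_N) :
  orthonormal_basis chi -> f = \sum_l gft chi f l *: chi l.
Proof.
move=> ortho.
pose U : 'M[R[i]]_N := \matrix_(i, l) chi l i 0.
pose V : 'M[R[i]]_N := \matrix_(l, i) conjc (chi l i 0).
have VU1 : V *m U = 1%:M.
  apply/matrixP=> l k; rewrite !mxE eq_sym -ortho.
  by apply: eq_bigr => i _; rewrite !mxE mulrC.
rewrite -[LHS]mul1mx -(mulmx1C VU1) -mulmxA.
apply/matrixP=> i j; rewrite (ord1 j) summxE mxE; apply: eq_bigr => l _.
rewrite !mxE mulrC; congr (_ * _).
by apply: eq_bigr => k _; rewrite mxE mulrC.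
Qed.

(** The entries of [L u] sum to [sum_j (sum_i L i j) * u j], which is zero
    because the columns of [L] sum to zero; they also sum to [a] times the sum
    of the entries of [u]. *)
Lemma sum_laplacian_eigenvector (R : realType) (N : nat) (W : 'M[R]_N)
    (a : R[i]) (u : 'cV[R[i]]_N) :
  W^T = W -> map_mx (real_complex R) (laplacian W) *m u = a *: u ->
  a != 0 -> \sum_i u i 0 = 0.
Proof.
move=> symW eig_u a_neq0; apply: (mulfI a_neq0); rewrite mulr0.
have col0 j : \sum_i laplacian W i j = 0.
  under eq_bigr => i _ do rewrite !mxE.
  rewrite big_split /= (bigD1 j) //= eqxx mulr1n.
  rewrite [X in _ + X + _]big1 => [|i neq_ij]; last first.
    by rewrite (negbTE neq_ij) mulr0n.
  rewrite addr0 sumrN; apply/eqP; rewrite subr_eq0; apply/eqP.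
  by apply: eq_bigr => i _; rewrite -[in LHS]symW mxE.
have -> : a * \sum_i u i 0 = \sum_i (a *: u) i 0.
  by rewrite mulr_sumr; apply: eq_bigr => i _; rewrite mxE.
rewrite -eig_u; under eq_bigr => i _ do rewrite mxE.
rewrite exchange_big big1 //= => j _; rewrite -mulr_suml.
under eq_bigr => i _ do rewrite mxE.
by rewrite -rmorph_sum /= col0 rmorph0 mul0r.
Qed.

(** The constant signal is the source of information about [chi ord0] at every
    single vertex: all its Fourier coefficients but the zeroth vanish. *)
Lemma chi0_neq0 (R : realType) (m : nat) (W : 'M[R]_m.+1)
    (lambda : 'I_m.+1 -> R) (chi : 'I_m.+1 -> 'cV[R[i]]_m.+1) :
  W^T = W -> laplacian_eigenbasis W lambda chi ->
  forall n, chi ord0 n 0 != 0.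
Proof.
move=> symW [ortho eig _ lambda_gt0 _] n.
have gft1 l : l != ord0 -> gft chi (const_mx 1) l = 0.
  move=> l_neq0; rewrite /gft /inner.
  under eq_bigr => i _ do rewrite mxE mul1r.
  rewrite -rmorph_sum /= (sum_laplacian_eigenvector _ _ _ _ _ symW (eig l)).
    exact: conjc0.
  by rewrite fmorph_eq0 gt_eqF ?lambda_gt0.
have /matrixP/(_ n 0) := fourier_inversion _ _ _ (const_mx 1) ortho.
rewrite (bigD1 ord0) //= big1 => [|l l_neq0]; last by rewrite gft1 ?scale0r.
rewrite addr0 !mxE => one_eq; apply/eqP => chi0n.
by move/eqP: one_eq; rewrite chi0n mulr0 oner_eq0.
Qed.

(** The coefficient [conj (chi_l n)] occurs in both translates, once conjugated,
    so the phases of [chi_l n] cancel and each frequency is reweighted by a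
    nonnegative real. *)
Lemma inner_translation (R : realType) (N : nat)
    (chi : 'I_N -> 'cV[R[i]]_N) (n : 'I_N) (f h : 'cV[R[i]]_N) :
  orthonormal_basis chi ->
  inner (translation chi n f) (translation chi n h)
  = N%:R * \sum_l (conjc (gft chi h l) * gft chi f l) * `|chi l n 0| ^+ 2.
Proof.
move=> ortho; set s := (Num.sqrt (N%:R : R))%:C.
have translationE k : translation chi n k
    = \sum_l (s * (gft chi k l * conjc (chi l n 0))) *: chi l.
  apply/matrixP=> i j; rewrite (ord1 j) mxE summxE mulr_sumr.
  by apply: eq_bigr => l _; rewrite mxE !mulrA.
have ss : s * conjc s = N%:R.
  by rewrite conjc_real -rmorphM /= -expr2 sqr_sqrtr ?ler0n // rmorph_nat.
rewrite !translationE parseval // -ss mulr_sumr; apply: eq_bigr => l _.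
rewrite sqr_normc !rmorphM /= conjcK.
rewrite mulrACA; congr (_ * _).
by rewrite mulrACA; congr (_ * _); rewrite mulrC.
Qed.

Lemma Re_mul_normsq (R : realType) (w z : R[i]) :
  complex.Re (w * `|z| ^+ 2)
  = complex.Re w * (complex.Re z ^+ 2 + complex.Im z ^+ 2).
Proof. by rewrite -add_Re2_Im2; case: w => a b /=; rewrite mulr0 subr0. Qed.

Theorem lemma3p7 (R : realType) (m : nat) (e : rel 'I_m.+1)
    (W : 'M[R]_m.+1) (lambda : 'I_m.+1 -> R)
    (chi : 'I_m.+1 -> 'cV[R[i]]_m.+1)
    (he : connected_simple_graph e)
    (hW : weighted_adjacency e W)
    (hchi : laplacian_eigenbasis W lambda chi)
    (g gamma : 'cV[R[i]]_m.+1)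
    (hl : forall l : 'I_m.+1, l != ord0 ->
       0 <= complex.Re (conjc (gft chi g l) * gft chi gamma l))
    (h0 : 0 < complex.Re (conjc (gft chi g ord0) * gft chi gamma ord0)) :
  forall n : 'I_m.+1,
    inner (translation chi n gamma) (translation chi n g) != 0.
Proof.
move=> n; have [symW _ _ _] := hW; have [ortho _ _ _ _] := hchi.
have chi0n := chi0_neq0 _ _ _ _ _ symW hchi n.
rewrite inner_translation // mulf_neq0 ?pnatr_eq0 //.
set S := \sum_l _.
suff: 0 < complex.Re S by apply: contraTneq => ->; rewrite ltxx.
have ReD : {morph @complex.Re R : x y / x + y} by move=> [? ?] [? ?].
rewrite /S (big_morph _ ReD (erefl : complex.Re 0 = 0)) (bigD1 ord0) //=.
rewrite ltr_pwDl ?sumr_ge0 // => [|l l_neq0]; rewrite Re_mul_normsq.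
  rewrite mulr_gt0 // lt_def addr_ge0 ?sqr_ge0 // andbT.
  rewrite paddr_eq0 ?sqr_ge0 // !sqrf_eq0.
  by rewrite eq_complex in chi0n.
by rewrite mulr_ge0 ?hl ?addr_ge0 ?sqr_ge0.
Qed.
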